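(* Let $M\subset\mathbb C$ be a nonempty compact set and $K=p^{-1}(M)$. For $f\in C_\Lambda(M)$ the following hold: (i) $\sigma(f)=\{\hat f(z):\ z\in K\}$; (ii) $\rho(f)=|\hat f|_K=\lim_{n\to\infty}\|f^n\|^{1/n}\le\|f\|$; (iii) $f$ has an inverse in $C_\Lambda(M)$ if and only if $\hat f(z)\neq0$ for all $z\in K$; (iv) $\operatorname{rad} C_\Lambda(M)=\{f\in C_\Lambda(M):\ \hat f(z)=0\text{ for all }z\in K\}$.
   Context: Let $\Lambda=\{\lambda_1,\dots,\lambda_d\}\subset\mathbb C$ consist of $d$ distinct points, let $p(z)=(z-\lambda_1)\cdots(z-\lambda_d)$, and let $\delta_j(z)=\prod_{k\neq j}\frac{z-\lambda_k}{\lambda_j-\lambda_k}$ be the Lagrange interpolation polynomials. $C_\Lambda(M)$ is the commutative unital Banach algebra of continuous functions $f:M\to\mathbb C^d$ with unit $\mathbf 1=(1,\dots,1)^t$ and product (polyproduct) given componentwise by $$(f\circledcirc g)_i(w)=f_i(w)g_i(w)-w\sum_{j\neq i}\frac{(f_i(w)-f_j(w))(g_i(w)-g_j(w))}{p'(\lambda_j)(\lambda_i-\lambda_j)},$$ and norm $\|f\|=\sup_{|g|_M\le1}|f\circledcirc g|_M$, where $|f|_M=\max_{w\in M}\max_j|f_j(w)|$. Powers $f^n$ and inverses are with respect to $\circledcirc$. For $f\in C_\Lambda(M)$, $\hat f:p^{-1}(M)\to\mathbb C$ is $\hat f(z)=\sum_{j=1}^d\delta_j(z)f_j(p(z))$,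 and $|\hat f|_K=\sup_{z\in K}|\hat f(z)|$. The spectrum $\sigma(f)$ is the set of $\lambda\in\mathbb C$ such that $\lambda\mathbf 1-f$ has no inverse in $C_\Lambda(M)$, $\rho(f)=\max\{|\lambda|:\lambda\in\sigma(f)\}$, and $\operatorname{rad}$ denotes the Jacobson radical (the intersection of all maximal ideals). *)

(* Defs.v *)
From HB Require Import structures.
From mathcomp Require Import all_boot all_order all_algebra.
From mathcomp Require Import all_classical all_reals all_analysis.
From mathcomp Require Import complex.
Import Order.TTheory GRing.Theory Num.Theory.
Import numFieldNormedType.Exports.

Set Implicit Arguments.
Unset Strict Implicit.
Unset Printing Implicit Defensive.

Local Open Scope classical_set_scope.
Local Open Scope ring_scope.
Local Open Scope complex_scope.

(* [R[i]^o] is the field [R[i]] with the topology of its modulus; [R[i]] itself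
   has no topology declared on it.  The modulus with values in [R] is [normc]. *)
Notation modulus := ComplexField.Normc.normc.

Section PolyProduct.
Context {R : realType} {d : nat} (lam : 'I_d -> R[i]) (M : set R[i]^o).

Definition nodal : {poly R[i]} := \prod_(j < d) ('X - (lam j)%:P).

Definition lagrange_basis (j : 'I_d) : {poly R[i]} :=
  \prod_(k < d | k != j) ((lam j - lam k)^-1 *: ('X - (lam k)%:P)).

(* The domain is the subtype [set_type M] with the induced topology, so that
   Leibniz equality is equality of functions on M.  The algebra itself is the
   subset [CLambda] of [vfun]; inverses, test functions in the operator norm and
   ideals are restricted to it. *)
Definition vfun : Type := set_type M -> 'cV[R[i]]_d.

Definition CLambda : set vfun :=
  [set f | continuous (f : set_type M -> 'cV[R[i]^o]_d)].

Definition one_vfun : vfun := fun=> const_mx 1.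

Definition polyprod (f g : vfun) : vfun := fun w => \col_i
  (f w i 0 * g w i 0
   - (val w : R[i]) * \sum_(j < d | j != i)
       (f w i 0 - f w j 0) * (g w i 0 - g w j 0)
         / ((nodal^`()).[lam j] * (lam i - lam j))).

Definition polypow (f : vfun) (n : nat) : vfun := iter n (polyprod f) one_vfun.

Definition invertible (f : vfun) : Prop :=
  exists2 g : vfun, CLambda g & polyprod f g = one_vfun.

(* For continuous functions on a nonempty compact M the sets of reals below
   are nonempty and bounded, so [sup] is the genuine supremum. *)
Definition max_norm (f : vfun) : R :=
  sup (range (fun w : set_type M =>
    \big[Num.max/0]_(j < d) modulus (f w j 0))).

Definition op_norm (f : vfun) : R :=
  sup [set max_norm (polyprod f g) | g in
        [set g : vfun | CLambda g /\ max_norm g <= 1]].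

Definition spectrum (f : vfun) : set R[i] :=
  [set l | ~ invertible (fun w => l *: one_vfun w - f w)].

Definition spectral_radius (f : vfun) : R :=
  sup [set modulus l | l in spectrum f].

Definition lemniscate : set R[i]^o := [set z | M nodal.[z]].

Definition nodal_map (z : set_type lemniscate) : set_type M :=
  SigSub (mem_set (set_mem (valP z) : M nodal.[val z])).

Definition hat (f : vfun) (z : set_type lemniscate) : R[i] :=
  \sum_(j < d) (lagrange_basis j).[val z] * f (nodal_map z) j 0.

Definition hat_norm (f : vfun) : R := sup (range (fun z => modulus (hat f z))).

Definition ideal (J : set vfun) : Prop :=
  [/\ J `<=` CLambda, J (fun=> 0),
      forall f g, J f -> J g -> J (fun w => f w + g w) &
      forall f g, CLambda f -> J g -> J (polyprod f g)].

Definition maximal_ideal (J : set vfun) : Prop :=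
  [/\ ideal J, J <> CLambda &
      forall I, ideal I -> J `<=` I -> I = J \/ I = CLambda].

Definition jacobson_radical : set vfun :=
  CLambda `&` \bigcap_(J in maximal_ideal) J.

End PolyProduct.

Arguments vfun {R} d M.
Arguments jacobson_radical {R d} lam M _.
Arguments hat {R d} lam {M} f z.

Definition is_max {R : realType} (A : set R) (m : R) : Prop :=
  A m /\ ubound A m.

(* Main.v *)
Require Import Defs.
From HB Require Import structures.
From mathcomp Require Import all_boot all_order all_algebra.
From mathcomp Require Import all_classical all_reals all_analysis.
From mathcomp Require Import complex.
From mathcomp Require Import ring.
Import Order.TTheory GRing.Theory Num.Theory.
Import numFieldNormedType.Exports.
Import ComplexField.Normc.

Set Implicit Arguments.
Unset Strict Implicit.
Unset Printing Implicit Defensive.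

Local Open Scope classical_set_scope.
Local Open Scope ring_scope.
Local Open Scope complex_scope.

(** For a fixed w, the polyproduct on C^d is multiplication of polynomials
    modulo p - w.  A column u corresponds to its Lagrange interpolant
    F_u = sum_j u_j delta_j, the only polynomial of degree less than d with
    F_u(lambda_j) = u_j, and the products delta_i delta_j reduce modulo p - w to
    exactly the combination appearing in the polyproduct ([interpM]).  So the
    fibre over w is the algebra C[z]/(p - w), its characters are the evaluations
    at the points of p^-1(w), and f-hat collects these evaluations over all w.

    Inverses (iii), hence the spectrum (i).  If f-hat has no zero on K then, for
    each w, the interpolant of f(w) has no common root with p - w, so that
    multiplication by f(w) is injective on the fibre ([fibre_mul_eq0]).  Its
    matrix is then invertible, and Cramer's rule shows that the inverse depends
    continuously on w ([invertibleP]).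

    Spectral radius (ii).  Instead of the analyticity of the resolvent, the
    following estimate is used.  Let z_1, ..., z_d be the roots of p - w and let
    mu_k be the value of the interpolant F at z_k.  Then (F - mu_1)...(F - mu_d)
    is divisible by (z - z_1)...(z - z_d) = p - w, hence vanishes on the fibre
    ([fibre_mul_annihilator]).  An operator T with (T - mu_1)...(T - mu_d) = 0
    and all |mu_k| <= rho satisfies |T^n| <= C s^n for each s > rho, where C
    depends only on d, s, rho and a bound for T ([iter_growth]); C is therefore
    uniform over the compact set M.  With rho = |f-hat|_K this bounds ||f^n||
    from above.  From below, evaluations being bounded by a constant multiple of
    the maximum norm gives |f-hat|_K^n <= C ||f^n|| ([hat_norm_pow_le]).  Taking
    n-th roots proves the limit formula, and ||f^n|| <= ||f||^n the final
    inequality.  The maximum is attained because K is closed and bounded.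

    Radical (iv).  Each evaluation has a maximal ideal as kernel, so that the
    radical is contained in the set of f with f-hat = 0.  Conversely, if
    f-hat = 0 and a maximal ideal J does not contain f, then 1 = j + g f with
    j in J; evaluating, j-hat = 1, so j is invertible by (iii): a contradiction
    ([jacobson_radicalE]). *)

(** * The fibre algebra as polynomials modulo p - w *)

Section FibreAlgebra.
Context {R : realType} {d : nat} (lam : 'I_d -> R[i]).

(** The value of the polyproduct at one point, where the functions enter only
    through their columns u and v. *)
Definition fibre_mul (w : R[i]) (u v : 'cV[R[i]]_d) : 'cV[R[i]]_d := \col_i
  (u i 0 * v i 0
   - w * \sum_(j < d | j != i)
       (u i 0 - u j 0) * (v i 0 - v j 0)
         / (((nodal lam)^`()).[lam j] * (lam i - lam j))).

Definition interp (u : 'cV[R[i]]_d) : {poly R[i]} :=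
  \sum_(j < d) u j 0 *: lagrange_basis lam j.

Lemma fibre_mulC w u v : fibre_mul w u v = fibre_mul w v u.
Proof.
apply/colP => i; rewrite !mxE mulrC; congr (_ - _ * _).
by apply: eq_bigr => j _; rewrite [X in X / _]mulrC.
Qed.

Lemma fibre_mulDr w u v1 v2 :
  fibre_mul w u (v1 + v2) = fibre_mul w u v1 + fibre_mul w u v2.
Proof.
apply/colP => i; rewrite !mxE mulrDr.
rewrite [X in w * X](_ : _ = \sum_(j < d | j != i)
       ((u i 0 - u j 0) * (v1 i 0 - v1 j 0)
         / (((nodal lam)^`()).[lam j] * (lam i - lam j))) +
   \sum_(j < d | j != i)
       ((u i 0 - u j 0) * (v2 i 0 - v2 j 0)
         / (((nodal lam)^`()).[lam j] * (lam i - lam j)))); first by ring.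
rewrite -big_split /=; apply: eq_bigr => j _; rewrite !mxE -mulrDl -mulrDr.
by congr (_ * _ / _); ring.
Qed.

Lemma fibre_mulZr w c u v : fibre_mul w u (c *: v) = c *: fibre_mul w u v.
Proof.
apply/colP => i; rewrite !mxE mulrBr; congr (_ - _); first by rewrite mulrCA.
rewrite [RHS]mulrCA; congr (_ * _); rewrite mulr_sumr; apply: eq_bigr => j _.
by rewrite !mxE -mulrBr !mulrA [c * _]mulrC.
Qed.

Lemma fibre_mul1r w u : fibre_mul w u (const_mx 1) = u.
Proof.
apply/colP => i; rewrite !mxE mulr1 big1 ?mulr0 ?subr0// => j _.
by rewrite !mxE subrr mulr0 mul0r.
Qed.

Lemma interpD u v : interp (u + v) = interp u + interp v.
Proof.
by rewrite /interp -big_split; apply: eq_bigr => j _; rewrite mxE scalerDl.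
Qed.

Lemma interpZ c u : interp (c *: u) = c *: interp u.
Proof.
by rewrite /interp scaler_sumr; apply: eq_bigr => j _; rewrite mxE scalerA.
Qed.

Lemma interp0 : interp 0 = 0.
Proof. by rewrite /interp big1// => j _; rewrite mxE scale0r. Qed.

Lemma size_lagrange_basis j : (size (lagrange_basis lam j) <= d)%N.
Proof.
rewrite /lagrange_basis scaler_prod.
apply: (leq_trans (size_scale_leq _ _)).
rewrite (eq_bigl (fun k => k \in predC1 j)); last by move=> k; rewrite !inE.
rewrite -big_enum /= size_prod_XsubC.
have := cardC1 j; rewrite card_ord cardE => ->.
by rewrite prednK// (leq_ltn_trans _ (ltn_ord j)).
Qed.

Lemma size_interp u : (size (interp u) <= d)%N.
Proof.
apply: (leq_trans (size_sum _ _ _)); apply/bigmax_leqP => j _.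
exact: leq_trans (size_scale_leq _ _) (size_lagrange_basis j).
Qed.

Lemma nodal_monic : nodal lam \is monic.
Proof. exact: monic_prod_XsubC. Qed.

Lemma size_nodal : size (nodal lam) = d.+1.
Proof. by rewrite /nodal -big_enum size_prod_XsubC size_enum_ord. Qed.

Hypothesis d_gt0 : (0 < d)%N.

Lemma size_nodalB w : size (nodal lam - w%:P) = d.+1.
Proof.
rewrite size_polyDl ?size_nodal// size_polyN.
by rewrite (leq_ltn_trans (size_polyC_leq1 _))// ltnS.
Qed.

Lemma nodalB_monic w : nodal lam - w%:P \is monic.
Proof.
rewrite monicE lead_coefDl ?size_nodal; first exact: nodal_monic.
by rewrite size_polyN (leq_ltn_trans (size_polyC_leq1 _))// ltnS.
Qed.

(** Uniqueness of the representative of degree less than d of a class modulo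
    p - w: it turns congruences between interpolants into equalities of
    columns. *)
Lemma size_dvdp_eq0 w (p : {poly R[i]}) :
  (size p <= d)%N -> nodal lam - w%:P %| p -> p = 0.
Proof.
move=> sp; have [//|p0] := eqVneq p 0.
by move/dvdp_leq => /(_ p0); rewrite size_nodalB ltnNge sp.
Qed.

Hypothesis lam_inj : injective lam.

Lemma lagrange_basisE j k : (lagrange_basis lam j).[lam k] = (j == k)%:R.
Proof.
rewrite /lagrange_basis horner_prod; case: eqVneq => [<-|jk].
  apply: big1 => i ij; rewrite hornerZ hornerXsubC mulVf// subr_eq0.
  by apply: contra ij => /eqP/lam_inj->.
by rewrite (bigD1 k) 1?eq_sym//= hornerZ hornerXsubC subrr mulr0 mul0r.
Qed.

Lemma interpE u j : (interp u).[lam j] = u j 0.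
Proof.
rewrite /interp horner_sum (bigD1 j)//= hornerZ lagrange_basisE eqxx mulr1.
rewrite big1 ?addr0// => i ij.
by rewrite hornerZ lagrange_basisE (negbTE ij) mulr0.
Qed.

Lemma interp_inj : injective interp.
Proof. by move=> u v uv; apply/colP => j; rewrite -!interpE uv. Qed.

Lemma poly_interpolation (p : {poly R[i]}) :
  (size p <= d)%N -> p = interp (\col_j p.[lam j]).
Proof.
move=> sp; apply/eqP; rewrite -subr_eq0; apply/eqP.
pose s := [seq lam j | j <- enum 'I_d].
apply: (@roots_geq_poly_eq0 _ _ s).
- apply/allP => _ /mapP[j _ ->]; apply/rootP.
  by rewrite hornerD hornerN interpE mxE subrr.
- by rewrite map_inj_uniq// enum_uniq.
- rewrite size_map size_enum_ord (leq_trans (size_polyD _ _))// geq_max sp/=.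
  by rewrite size_polyN size_interp.
Qed.

Lemma interp_const1 : interp (const_mx 1) = 1.
Proof.
rewrite [RHS]poly_interpolation; last by rewrite size_poly1.
by congr interp; apply/colP => j; rewrite !mxE hornerC.
Qed.

Lemma deriv_nodal j :
  (nodal lam)^`().[lam j] = \prod_(k < d | k != j) (lam j - lam k).
Proof.
rewrite /nodal (bigD1 j)//= derivM derivXsubC mul1r hornerD hornerM.
rewrite hornerXsubC subrr mul0r addr0 horner_prod.
by apply: eq_bigr => k _; rewrite hornerXsubC.
Qed.

Lemma lagrange_basis_cofactor j : lagrange_basis lam j =
  (nodal lam)^`().[lam j]^-1 *: \prod_(k < d | k != j) ('X - (lam k)%:P).
Proof. by rewrite /lagrange_basis scaler_prod deriv_nodal prodfV. Qed.

(** With p_i = p / (z - lambda_i), so that delta_i = p_i / p'(lambda_i), this is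
    the partial fraction identity
    p_i p_j = p (p_i - p_j) / (lambda_i - lambda_j). *)
Lemma lagrange_basisM i j : i != j ->
  lagrange_basis lam i * lagrange_basis lam j =
  nodal lam * (((nodal lam)^`().[lam j] * (lam i - lam j))^-1 *: lagrange_basis lam i
             + ((nodal lam)^`().[lam i] * (lam j - lam i))^-1 *: lagrange_basis lam j).
Proof.
move=> ij; have ji : j != i by rewrite eq_sym.
have lij : lam i - lam j != 0.
  by rewrite subr_eq0; apply: contra ij => /eqP/lam_inj->.
have -> : (nodal lam)^`().[lam i] * (lam j - lam i) =
    - ((nodal lam)^`().[lam i] * (lam i - lam j)) by ring.
rewrite !lagrange_basis_cofactor invrN.
set a := _.[lam i]; set b := _.[lam j].
(* q is p / ((z - lambda_i) (z - lambda_j)); all three products are multiples of it *)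
pose q : {poly R[i]} := \prod_(k < d | (k != i) && (k != j)) ('X - (lam k)%:P).
have -> : \prod_(k < d | k != i) ('X - (lam k)%:P) = ('X - (lam j)%:P) * q.
  by rewrite (bigD1 j).
have -> : \prod_(k < d | k != j) ('X - (lam k)%:P) = ('X - (lam i)%:P) * q.
  by rewrite (bigD1 i)//=; congr (_ * _); apply: eq_bigl => k; rewrite andbC.
have -> : nodal lam = ('X - (lam i)%:P) * (('X - (lam j)%:P) * q).
  by rewrite /nodal (bigD1 i)//= (bigD1 j).
rewrite !invfM -!mul_polyC polyCN !polyCM.
have E : ((lam i - lam j)^-1)%:P * ((lam i)%:P - (lam j)%:P) = 1.
  by rewrite -polyCB -polyCM mulVf.
rewrite -[LHS]mulr1 -E; ring.
Qed.

(** Since the delta_i sum to 1, the product of two interpolants is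
    sum_i u_i v_i delta_i minus one half of
    sum_(i, j) (u_i - u_j) (v_i - v_j) delta_i delta_j.  By [lagrange_basisM] the
    double sum is p times a combination of the delta_i; replacing the factor p
    by w gives the interpolant of the polyproduct. *)
Lemma interpM w u v :
  nodal lam - w%:P %| interp u * interp v - interp (fibre_mul w u v).
Proof.
pose D := lagrange_basis lam.
pose t i j := ((nodal lam)^`().[lam j] * (lam i - lam j))^-1.
pose s i j := (u i 0 - u j 0) * (v i 0 - v j 0).
have D1 : \sum_j D j = 1.
  by rewrite -interp_const1; apply: eq_bigr => j _; rewrite mxE scale1r.
pose S := \sum_i (\sum_(j < d | j != i) s i j * t i j) *: D i.
have two : (2%:R : {poly R[i]}) != 0.
  by rewrite -polyC_natr polyC_eq0 pnatr_eq0.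
have UV : interp u * interp v = \sum_i (u i 0 * v i 0) *: D i - nodal lam * S.
  (* doubling avoids choosing an order on the pairs (i, j) *)
  apply: (mulfI two).
  have pol : \sum_i \sum_j (s i j) *: (D i * D j) =
    2%:R * \sum_i (u i 0 * v i 0) *: D i - 2%:R * (interp u * interp v).
    transitivity (\sum_i \sum_j ((u i 0 * v i 0) *: D i) * D j
      + \sum_i \sum_j D i * ((u j 0 * v j 0) *: D j)
      - \sum_i \sum_j (u i 0 *: D i) * (v j 0 *: D j)
      - \sum_i \sum_j (v i 0 *: D i) * (u j 0 *: D j)).
      rewrite -big_split -!sumrB/=; apply: eq_bigr => i _.
      rewrite -big_split -!sumrB/=; apply: eq_bigr => j _.
      rewrite /s -!mul_polyC !(polyCM, polyCB); ring.
    rewrite -!big_distrlr/= D1 mulr1 mul1r.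
    rewrite -/(interp u) -/(interp v); ring.
  have sym : \sum_i \sum_j (s i j) *: (D i * D j) = 2%:R * (nodal lam * S).
    transitivity (\sum_i \sum_(j | j != i) (s i j * t i j) *: (nodal lam * D i)
      + \sum_i \sum_(j | j != i) (s j i * t j i) *: (nodal lam * D j)).
      rewrite -big_split/=; apply: eq_bigr => i _.
      rewrite (bigD1 i)//= {1}/s subrr mul0r scale0r add0r -big_split/=.
      apply: eq_bigr => j ji; rewrite lagrange_basisM 1?eq_sym//.
      have -> : s j i = s i j by rewrite /s; ring.
      rewrite -/(t i j) -/(t j i) -/(D i) -/(D j).
      move: (s i j) (t i j) (t j i) => a b c.
      rewrite -!mul_polyC !polyCM; ring.
    have -> : \sum_i \sum_(j | j != i) (s j i * t j i) *: (nodal lam * D j)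
       = \sum_i \sum_(j | j != i) (s i j * t i j) *: (nodal lam * D i).
      rewrite (exchange_big_dep xpredT)//=; apply: eq_bigr => i _.
      by apply: eq_bigl => j; rewrite eq_sym.
    have -> : \sum_i \sum_(j | j != i) (s i j * t i j) *: (nodal lam * D i) =
        nodal lam * S; last by ring.
    rewrite /S mulr_sumr; apply: eq_bigr => i _.
    by rewrite -scaler_suml -scalerAr.
  move: pol; rewrite sym => pol; rewrite mulrBr pol; ring.
have -> : interp (fibre_mul w u v) = \sum_i (u i 0 * v i 0) *: D i - w%:P * S.
  rewrite /interp /S mulr_sumr -sumrB; apply: eq_bigr => i _.
  by rewrite mxE scalerBl mul_polyC scalerA.
rewrite UV; apply/dvdpP; exists (- S); ring.
Qed.

Lemma fibre_mulA w u v x :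
  fibre_mul w u (fibre_mul w v x) = fibre_mul w (fibre_mul w u v) x.
Proof.
apply: interp_inj; apply/eqP; rewrite -subr_eq0; apply/eqP.
apply: (@size_dvdp_eq0 w).
  rewrite (leq_trans (size_polyD _ _))// geq_max size_polyN.
  by rewrite !size_interp.
have H1 := interpM w u (fibre_mul w v x).
have H2 := interpM w (fibre_mul w u v) x.
have H3 := dvdp_mull (interp u) (interpM w v x).
have H4 := dvdp_mulr (interp x) (interpM w u v).
have := dvdp_sub (dvdp_add H1 H3) (dvdp_add H2 H4).
rewrite -dvdpNr; congr (_ %| _); ring.
Qed.

Lemma horner_interpM u v z : (interp (fibre_mul (nodal lam).[z] u v)).[z] =
  (interp u).[z] * (interp v).[z].
Proof.
apply/esym/eqP; rewrite -subr_eq0 -hornerM -hornerN -hornerD.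
have /dvdpP[q ->] := interpM (nodal lam).[z] u v.
by rewrite hornerM hornerD hornerN hornerC subrr mulr0.
Qed.

(** The hypothesis says that the interpolant of u and p - w have no common root,
    so they are coprime; p - w then divides the interpolant of v, whose degree is
    too small. *)
Lemma fibre_mul_eq0 w u v :
  (forall z, (nodal lam).[z] = w -> (interp u).[z] != 0) ->
  fibre_mul w u v = 0 -> v = 0.
Proof.
move=> u0 uv0; apply: interp_inj.
rewrite interp0; apply: (@size_dvdp_eq0 w); first exact: size_interp.
rewrite -(@Gauss_dvdpr _ _ (interp u)).
  by have := interpM w u v; rewrite uv0 interp0 subr0.
apply/Pdiv.ClosedField.coprimepP => z /rootP.
rewrite hornerD hornerN hornerC => /eqP; rewrite subr_eq0 => /eqP; exact: u0.
Qed.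

Lemma nodalB_factor w : exists2 r : seq R[i], nodal lam - w%:P =
  \prod_(z <- r) ('X - z%:P) & size r = d /\ {in r, forall z, (nodal lam).[z] = w}.
Proof.
have [r rE] := closed_field_poly_normal (nodal lam - w%:P).
move: (rE); rewrite (monicP (nodalB_monic w)) scale1r => {}rE.
exists r => //; split.
  by have := size_nodalB w; rewrite rE size_prod_XsubC => -[].
move=> z zr; apply/eqP; rewrite -subr_eq0 -(hornerC w z) -hornerN -hornerD.
by rewrite rE; apply/eqP/rootP; rewrite root_prod_XsubC.
Qed.

End FibreAlgebra.

(** * Moduli and the maximum norm of columns *)

Section Modulus.
Context {R : realType}.
Implicit Types x y : R[i].

Lemma modulus_ge0 x : 0 <= modulus x.
Proof. by case: x => a b; exact: sqrtr_ge0. Qed.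

Lemma modulusN x : modulus (- x) = modulus x.
Proof. exact: (@normcN R x). Qed.

Lemma modulusD_le x y : modulus (x + y) <= modulus x + modulus y.
Proof. exact: (@le_normcD R x y). Qed.

Lemma modulusB_le x y : modulus (x - y) <= modulus x + modulus y.
Proof. by rewrite (le_trans (modulusD_le _ _))// modulusN. Qed.

Lemma modulus_sum_le (I : Type) (s : seq I) (P : pred I) (F : I -> R[i]) :
  modulus (\sum_(i <- s | P i) F i) <= \sum_(i <- s | P i) modulus (F i).
Proof.
elim/big_rec2: _ => [|i y z _ yz]; first by rewrite normc0.
by rewrite (le_trans (modulusD_le _ _))// lerD2l.
Qed.

Lemma modulusX x n : modulus (x ^+ n) = modulus x ^+ n.
Proof. by elim: n => [|n IH]; rewrite ?expr0 ?normc1// !exprS normcM IH. Qed.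

End Modulus.

Section ColumnNorm.
Context {R : realType} {d : nat}.
Implicit Types u v : 'cV[R[i]]_d.

Definition colnorm u : R := \big[Num.max/0]_(j < d) modulus (u j 0).

Lemma colnorm_ge0 u : 0 <= colnorm u.
Proof. by rewrite /colnorm; elim/big_rec: _ => // j x _ x0; rewrite le_max x0 orbT. Qed.

Lemma modulus_le_colnorm u j : modulus (u j 0) <= colnorm u.
Proof. by rewrite /colnorm; apply: (le_bigmax _ (fun j => modulus (u j 0))). Qed.

Lemma colnorm_le u (c : R) :
  0 <= c -> (forall j, modulus (u j 0) <= c) -> colnorm u <= c.
Proof. by move=> c0 h; apply: bigmax_le. Qed.

Lemma colnorm0 : colnorm 0 = 0.
Proof.
apply/eqP; rewrite eq_le colnorm_ge0 andbT.
by apply: colnorm_le => // j; rewrite mxE normc0.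
Qed.

Lemma colnormD_le u v : colnorm (u + v) <= colnorm u + colnorm v.
Proof.
apply: colnorm_le => [|j]; first by rewrite addr_ge0 ?colnorm_ge0.
by rewrite mxE (le_trans (modulusD_le _ _))// lerD ?modulus_le_colnorm.
Qed.

Lemma colnormZ_le c u : colnorm (c *: u) <= modulus c * colnorm u.
Proof.
apply: colnorm_le => [|j]; first by rewrite mulr_ge0 ?colnorm_ge0 ?modulus_ge0.
by rewrite mxE normcM ler_wpM2l ?modulus_ge0 ?modulus_le_colnorm.
Qed.

Lemma modulus_entryB_le u i j : modulus (u i 0 - u j 0) <= 2 * colnorm u.
Proof.
rewrite (le_trans (modulusB_le _ _))// mulr_natl mulr2n.
by rewrite lerD ?modulus_le_colnorm.
Qed.

End ColumnNorm.

(** * Growth of the powers of an operator annihilated by linear factors *)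

Section Growth.
Context {R : realType} {d : nat} (T : 'cV[R[i]]_d -> 'cV[R[i]]_d).
Hypothesis linT : linear T.

Definition shifted_prod (mus : seq R[i]) (v : 'cV[R[i]]_d) : 'cV[R[i]]_d :=
  foldl (fun x mu => T x - mu *: x) v mus.

Lemma iter_linear n : linear (iter n T).
Proof. by elim: n => [|n IH] c x y //=; rewrite IH linT. Qed.

(** The constant is the solution of the recursion that closes the induction of
    [iter_growth]: peeling off one factor T - mu multiplies the norm by at most
    L + rho, and summing the resulting geometric series costs 1 / (s - rho). *)
Definition growth_const (s rho L : R) (k : nat) : R :=
  iter k (fun c => 1 + c * (L + rho) / (s - rho)) 0.

Lemma growth_const_ge0 s rho L k :
  0 <= rho -> rho < s -> 0 <= L -> 0 <= growth_const s rho L k.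
Proof.
move=> rho0 rhos L0; elim: k => //= k IH; rewrite addr_ge0// divr_ge0//.
  by rewrite mulr_ge0// addr_ge0.
by rewrite subr_ge0 ltW.
Qed.

(** Induction on the number of factors.  If v' = T v - mu v then T^(n+1) v =
    mu T^n v + T^n v', where v' is annihilated by one factor less; hence T^n v is
    a geometric sequence of ratio at most rho perturbed by a term of order s^n,
    and a ratio strictly below s absorbs the perturbation.  Coinciding mu
    cause no difficulty, and the bound depends on T only through L. *)
Lemma iter_growth (s rho L : R) (mus : seq R[i]) v n :
  0 <= rho -> rho < s -> 0 <= L ->
  (forall x, colnorm (T x) <= L * colnorm x) ->
  {in mus, forall mu, modulus mu <= rho} ->
  shifted_prod mus v = 0 ->
  colnorm (iter n T v) <= growth_const s rho L (size mus) * s ^+ n * colnorm v.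
Proof.
move=> rho0 rhos L0 TL; have s0 : 0 <= s by rewrite (le_trans rho0) ?ltW.
elim: mus v n => [|mu mus IH] v n musrho.
  rewrite /shifted_prod/= => ->; rewrite colnorm0 mulr0.
  suff -> : iter n T 0 = 0 by rewrite colnorm0.
  have := iter_linear n (-1) 0 0.
  by rewrite scaler0 addr0 scaleN1r addNr.
rewrite /shifted_prod/= -/(shifted_prod _ _).
set v' := T v - mu *: v => v'0; pose C := growth_const s rho L (size mus).
have murho : modulus mu <= rho by apply: musrho; rewrite mem_head.
have C0 : 0 <= C by exact: growth_const_ge0.
have v'le : colnorm v' <= (L + rho) * colnorm v.
  rewrite (le_trans (colnormD_le _ _))// mulrDl lerD//.
  rewrite -scaleNr (le_trans (colnormZ_le _ _))// modulusN.
  by rewrite ler_wpM2r// colnorm_ge0.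
have v'n m : colnorm (iter m T v') <= C * (L + rho) * s ^+ m * colnorm v.
  have {}musrho : {in mus, forall mu, modulus mu <= rho}.
    by move=> x xm; apply: musrho; rewrite inE xm orbT.
  apply: (le_trans (IH v' m musrho v'0)); rewrite -/C.
  rewrite (_ : _ * colnorm v = C * s ^+ m * ((L + rho) * colnorm v)); last by ring.
  by rewrite ler_wpM2l// mulr_ge0// exprn_ge0.
pose D := 1 + C * (L + rho) / (s - rho).
rewrite -/C -/D.
(* the choice of D makes D s^n dominate one step of the recurrence *)
have D1 : C * (L + rho) <= (s - rho) * D.
  have srho : s - rho != 0 by rewrite subr_eq0 gt_eqF.
  have -> : (s - rho) * D = s - rho + C * (L + rho) by rewrite /D; field.
  by rewrite lerDr subr_ge0 ltW.
have D1' : 0 <= D.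
  rewrite /D addr_ge0// divr_ge0 ?subr_ge0 ?(ltW rhos)//.
  by rewrite mulr_ge0// addr_ge0.
elim: n => [|n IHn].
  rewrite expr0 mulr1 /= -[leLHS]mul1r ler_wpM2r ?colnorm_ge0//.
  rewrite /D lerDl divr_ge0 ?subr_ge0 ?(ltW rhos)//.
  by rewrite mulr_ge0// addr_ge0.
have -> : iter n.+1 T v = mu *: iter n T v + iter n T v'.
  by rewrite iterSr -(iter_linear n) /v' addrCA subrr addr0.
rewrite (le_trans (colnormD_le _ _))//.
have -> : D * s ^+ n.+1 * colnorm v =
    rho * (D * s ^+ n * colnorm v) + (s - rho) * D * (s ^+ n * colnorm v).
  by rewrite exprS; ring.
apply: lerD.
  by rewrite (le_trans (colnormZ_le _ _))// ler_pM ?modulus_ge0 ?colnorm_ge0.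
rewrite (le_trans (v'n n))// -mulrA ler_wpM2r// mulr_ge0 ?colnorm_ge0//.
exact: exprn_ge0.
Qed.

End Growth.

(** * Estimates and invertibility in a fibre *)

Section FibreNorm.
Context {R : realType} {d : nat} (lam : 'I_d -> R[i]).

(** The factor 4 comes from |(u_i - u_j) (v_i - v_j)| <= 2 |u| 2 |v|. *)
Definition fibre_mul_bound (W : R) : R :=
  1 + W * \sum_i \sum_(j < d | j != i)
    4 * modulus ((nodal lam)^`().[lam j] * (lam i - lam j))^-1.

Lemma fibre_mul_bound_ge0 W : 0 <= W -> 0 <= fibre_mul_bound W.
Proof.
move=> W0; rewrite addr_ge0// mulr_ge0//.
by apply: sumr_ge0 => i _; apply: sumr_ge0 => j _; rewrite mulr_ge0 ?modulus_ge0.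
Qed.

Lemma colnorm_fibre_mul_le W w u v : modulus w <= W ->
  colnorm (fibre_mul lam w u v) <= fibre_mul_bound W * colnorm u * colnorm v.
Proof.
move=> wW; have W0 : 0 <= W by rewrite (le_trans (modulus_ge0 w)).
have uv0 : 0 <= colnorm u * colnorm v by rewrite mulr_ge0 ?colnorm_ge0.
rewrite -mulrA; apply: colnorm_le => [|i].
  by rewrite mulr_ge0// fibre_mul_bound_ge0.
rewrite mxE (le_trans (modulusB_le _ _))//.
rewrite /fibre_mul_bound; set S := \sum_i _.
rewrite (_ : (1 + W * S) * (colnorm u * colnorm v) =
  colnorm u * colnorm v + W * (S * (colnorm u * colnorm v))); last by ring.
rewrite lerD//.
  by rewrite normcM ler_pM ?modulus_ge0 ?modulus_le_colnorm.
rewrite normcM ler_pM ?modulus_ge0//.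
rewrite (le_trans (modulus_sum_le _ _ _))//.
rewrite [S](bigD1 i)//= mulrDl -[leLHS]addr0 lerD//; last first.
  rewrite mulr_ge0//; apply: sumr_ge0 => k _; apply: sumr_ge0 => j _.
  by rewrite mulr_ge0 ?modulus_ge0.
rewrite mulr_suml; apply: ler_sum => j _.
rewrite normcM mulrAC ler_wpM2r ?modulus_ge0// normcM.
rewrite (_ : 4 * _ = (2 * colnorm u) * (2 * colnorm v)); last by ring.
by rewrite ler_pM ?modulus_ge0 ?modulus_entryB_le.
Qed.

Hypothesis d_gt0 : (0 < d)%N.
Hypothesis lam_inj : injective lam.

Lemma fibre_mul_linear w u : linear (fibre_mul lam w u).
Proof. by move=> c x y; rewrite fibre_mulDr fibre_mulZr. Qed.

Lemma interp_shifted_prod w u (mus : seq R[i]) v :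
  nodal lam - w%:P %| \prod_(mu <- mus) (interp lam u - mu%:P) * interp lam v
    - interp lam (shifted_prod (fibre_mul lam w u) mus v).
Proof.
elim: mus v => [|mu mus IH] v /=; first by rewrite big_nil mul1r subrr dvdp0.
rewrite big_cons -/(shifted_prod _ _ _).
set v' := fibre_mul lam w u v - _; have := IH v'.
have : nodal lam - w%:P %|
    \prod_(mu <- mus) (interp lam u - mu%:P) *
      ((interp lam u - mu%:P) * interp lam v - interp lam v').
  apply: dvdp_mull; rewrite /v' -scaleNr interpD interpZ.
  have := interpM d_gt0 lam_inj w u v; congr (_ %| _).
  by rewrite -mul_polyC polyCN; ring.
move=> h1 h2; have := dvdp_add h1 h2; congr (_ %| _); ring.
Qed.

(** Each z in r divides F - F(z) by the factor theorem, so the product of the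
    F - F(z) is a multiple of p - w.  This plays the role of the Cayley-Hamilton
    theorem for multiplication by u, without computing a characteristic
    polynomial. *)
Lemma fibre_mul_annihilator w u (r : seq R[i]) v :
  nodal lam - w%:P = \prod_(z <- r) ('X - z%:P) ->
  shifted_prod (fibre_mul lam w u) [seq (interp lam u).[z] | z <- r] v = 0.
Proof.
move=> rE; apply: (interp_inj lam_inj).
rewrite interp0; apply: (@size_dvdp_eq0 _ _ lam d_gt0 w); first exact: size_interp.
set p := \prod_(mu <- [seq (interp lam u).[z] | z <- r])
  (interp lam u - mu%:P) * interp lam v.
have pdvd : nodal lam - w%:P %| p.
  apply: dvdp_mulr; rewrite big_map rE.
  elim: (r) => [|z r' IH]; first by rewrite !big_nil dvdpp.
  rewrite !big_cons dvdp_mul// dvdp_XsubCl; apply/rootP.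
  by rewrite hornerD hornerN hornerC subrr.
have := dvdp_sub pdvd (interp_shifted_prod w u [seq (interp lam u).[z] | z <- r] v).
by rewrite -/p subKr.
Qed.

(** The constant is the same for all w and u within the bounds W and A, hence for
    all values of a bounded function on a bounded set. *)
Lemma fibre_power_growth (W A s rho : R) w u v n :
  0 <= rho -> rho < s -> modulus w <= W -> colnorm u <= A ->
  (forall z, (nodal lam).[z] = w -> modulus (interp lam u).[z] <= rho) ->
  colnorm (iter n (fibre_mul lam w u) v)
    <= growth_const s rho (fibre_mul_bound W * A) d * s ^+ n * colnorm v.
Proof.
move=> rho0 rhos wW uA urho; have [r rE [sr rw]] := nodalB_factor lam d_gt0 w.
have W0 : 0 <= W by rewrite (le_trans (modulus_ge0 w)).
have A0 : 0 <= A by rewrite (le_trans (colnorm_ge0 u)).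
rewrite -[in growth_const _ _ _ _]sr -(size_map (fun z => (interp lam u).[z])).
apply: iter_growth => //.
- exact: fibre_mul_linear.
- by rewrite mulr_ge0// fibre_mul_bound_ge0.
- move=> x; rewrite (le_trans (colnorm_fibre_mul_le _ _ wW))//.
  by rewrite ler_wpM2r ?colnorm_ge0// ler_wpM2l// fibre_mul_bound_ge0.
- by move=> _ /mapP[z /rw zw ->]; apply: urho.
- exact: fibre_mul_annihilator.
Qed.

Definition fibre_mx w u : 'M[R[i]]_d :=
  \matrix_(i, j) fibre_mul lam w u (delta_mx j 0) i 0.

Lemma fibre_mxE w u v : fibre_mx w u *m v = fibre_mul lam w u v.
Proof.
have lin (s : seq 'I_d) : fibre_mul lam w u (\sum_(j <- s) v j 0 *: delta_mx j 0)
    = \sum_(j <- s) v j 0 *: fibre_mul lam w u (delta_mx j 0).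
  elim: s => [|j s IH]; last by rewrite !big_cons fibre_mul_linear IH.
  by rewrite !big_nil -[X in fibre_mul _ _ _ X](scale0r 0) fibre_mulZr scale0r.
have -> : v = \sum_j v j 0 *: delta_mx j 0.
  by rewrite [LHS]matrix_sum_delta; apply: eq_bigr => j _; rewrite big_ord1.
rewrite lin; apply/colP => i; rewrite mxE summxE; apply: eq_bigr => j _.
rewrite !mxE mulrC; congr (_ * _).
rewrite summxE (bigD1 j)//= big1 ?addr0; last first.
  by move=> k kj; rewrite !mxE eq_sym (negbTE kj) mulr0.
by rewrite !mxE !eqxx mulr1.
Qed.

Lemma fibre_mx_unit w u :
  (forall z, (nodal lam).[z] = w -> (interp lam u).[z] != 0) ->
  fibre_mx w u \in unitmx.
Proof.
move=> u0; rewrite -unitmx_tr -row_free_unit; apply: inj_row_free => v.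
move=> /(congr1 trmx); rewrite trmx_mul trmxK trmx0 fibre_mxE.
by move=> /(fibre_mul_eq0 d_gt0 lam_inj u0)/(congr1 trmx); rewrite trmxK trmx0.
Qed.

End FibreNorm.

(** * Continuity of matrix entries and compactness in the complex plane *)

Section Topology.

Lemma compact_set_type (X : topologicalType) (A : set X) :
  compact A -> compact [set: set_type A].
Proof.
move=> cA F FF _.
have FA : nbhs ((val : set_type A -> X) @ F) A.
  suff : F [set x : set_type A | A (val x)] by [].
  by apply: filterS filterT => x _; exact: set_mem (valP x).
have [p [Ap clp]] := cA _ (fmap_proper_filter _ FF) FA.
exists (SigSub (mem_set Ap)); split => // B C FB [D [[E oE <-] /= Ep EC]].
have FB' : ((val : set_type A -> X) @ F) (val @` B).
  suff : F [set x : set_type A | (val @` B) (val x)] by [].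
  by apply: filterS FB => x Bx; exists x.
have [_ [[x Bx <-] Ex]] := clp _ E FB' (open_nbhs_nbhs (conj oE Ep)).
by exists x; split => //; apply: EC.
Qed.

Context {K : numFieldType} {T : topologicalType}.

Lemma continuous_mx_entryP m n (f : T -> 'M[K]_(m, n)) :
  (forall i j, continuous (fun t => f t i j)) <-> continuous f.
Proof.
split=> [cf t U [P nP sPU]|cf i j t].
  have : \forall s \near t, forall i j, P i j (f s i j).
    apply: filter_forall => i; apply: filter_forall => j.
    exact: (cf i j t _ (nP i j)).
  by apply: filterS => s Ps; apply: sPU.
apply: (@continuous_comp _ _ _ f (fun M : 'M[K]_(m, n) => M i j)); first exact: cf.
exact: coord_continuous.
Qed.

Lemma continuous_bigsum (I : Type) (r : seq I) (P : pred I) (F : I -> T -> K) :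
  (forall i, P i -> continuous (F i)) ->
  continuous (fun t => \sum_(i <- r | P i) F i t).
Proof. by apply: continuous_big; exact: add_continuous. Qed.

Lemma continuous_bigprod (I : Type) (r : seq I) (P : pred I) (F : I -> T -> K) :
  (forall i, P i -> continuous (F i)) ->
  continuous (fun t => \prod_(i <- r | P i) F i t).
Proof. by apply: continuous_big; exact: mul_continuous. Qed.

Lemma continuous_mul (f g : T -> K) :
  continuous f -> continuous g -> continuous (fun t => f t * g t).
Proof. by move=> cf cg t; apply: continuousM; [exact: cf|exact: cg]. Qed.

Lemma continuous_add (f g : T -> K) :
  continuous f -> continuous g -> continuous (fun t => f t + g t).
Proof. by move=> cf cg t; apply: continuousD; [exact: cf|exact: cg]. Qed.

Lemma continuous_sub (f g : T -> K) :
  continuous f -> continuous g -> continuous (fun t => f t - g t).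
Proof. by move=> cf cg t; apply: continuousB; [exact: cf|exact: cg]. Qed.

Lemma continuous_det n (A : T -> 'M[K]_n) :
  (forall i j, continuous (fun t => A t i j)) -> continuous (fun t => \det (A t)).
Proof.
move=> cA; apply: continuous_bigsum => s _.
apply: continuous_mul; first by move=> t; exact: cst_continuous.
by apply: continuous_bigprod => i _; exact: cA.
Qed.

Lemma continuous_invmx n (A : T -> 'M[K]_n) :
  (forall t, A t \in unitmx) ->
  (forall i j, continuous (fun t => A t i j)) ->
  forall i j, continuous (fun t => invmx (A t) i j).
Proof.
move=> uA cA i j.
rewrite (_ : (fun t => _) = fun t => (\det (A t))^-1 * cofactor (A t) j i).
  apply: continuous_mul.
    move=> t; apply: (@continuousV K T (fun t => \det (A t))); last exact: continuous_det.
    by have := uA t; rewrite unitmxE unitfE.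
  apply: continuous_mul; first by move=> t; exact: cst_continuous.
  apply: continuous_det => k l.
  rewrite (_ : (fun t => _) = fun t => A t (lift j k) (lift i l)) //.
  by apply/funext => t; rewrite !mxE.
by apply/funext => t; rewrite /invmx uA !mxE.
Qed.

End Topology.

Lemma horner_continuous (K : numFieldType) (p : {poly K}) :
  continuous (fun z : K => p.[z]).
Proof.
elim/poly_ind: p => [|p c IH].
  by under eq_fun do rewrite horner0; move=> z; exact: cst_continuous.
under eq_fun do rewrite hornerMXaddC.
apply: continuous_add; last by move=> z; exact: cst_continuous.
by apply: continuous_mul => // z; exact: cvg_id.
Qed.

Section ComplexTopology.
Context {R : realType}.

Lemma complex_nbhsP (z : R[i]^o) (U : set R[i]^o) : nbhs z U <->
  exists2 e : R, 0 < e & forall y : R[i], modulus (z - y) < e -> U y.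
Proof.
split=> [/nbhs_ballP[[e e'] /=]|[e e0 zU]].
  rewrite ltcE/= => /andP[/eqP-> e0] zU; exists e => // y zy; apply: zU.
  by rewrite -ball_normE /ball_/= -[`|_|]/((modulus (z - y))%:C) ltcR.
apply/nbhs_ballP; exists e%:C; rewrite /= ?ltcR// => y.
rewrite -ball_normE /ball_/= -[`|_|]/((modulus (z - y))%:C) ltcR; exact: zU.
Qed.

Lemma modulus_continuous : continuous (fun z : R[i]^o => modulus z : R).
Proof.
move=> z U /nbhs_ballP[e /= e0 zU]; apply/complex_nbhsP; exists e => // y zy.
apply: zU; rewrite -ball_normE /ball_/=; apply: le_lt_trans zy.
have h (a b : R[i]) : modulus a <= modulus (a - b) + modulus b.
  by rewrite (le_trans _ (modulusD_le _ _))// subrK.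
rewrite ler_norml; apply/andP; split; last by rewrite lerBlDr.
by rewrite lerNl opprB lerBlDr -(modulusN (z - y)) opprB.
Qed.

Lemma complex_of_pair_continuous :
  continuous (fun p : R * R => (p.1 +i* p.2 : R[i]^o)).
Proof.
move=> [a b] U /complex_nbhsP[e e0 zU].
have e20 : 0 < e / 2 by rewrite divr_gt0.
exists (ball a (e / 2), ball b (e / 2)).
  by split; exact: nbhsx_ballx.
move=> [x y] [/= ax bxy]; apply: zU.
have -> : (a +i* b) - (x +i* y) = (a - x)%:C + 'i * (b - y)%:C :> R[i].
  by apply/eqP; rewrite eq_complex /=; apply/andP; split; apply/eqP; ring.
rewrite (le_lt_trans (modulusD_le _ _))// normcM [X in _ + X * _](_ : _ = 1).
  rewrite mul1r [ltRHS]splitr; move: ax bxy; rewrite -!ball_normE /ball_/= => ax bxy.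
  by rewrite ltrD// /modulus /= expr0n addr0 sqrtr_sqr.
by rewrite /= expr0n add0r expr1n sqrtr1.
Qed.

Lemma ge_modulus_coord (z : R[i]) :
  `|complex.Re z| <= modulus z /\ `|complex.Im z| <= modulus z.
Proof.
case: z => a b /=; split; rewrite -sqrtr_sqr ler_sqrt ?addr_ge0 ?sqr_ge0//.
  by rewrite lerDl sqr_ge0.
by rewrite lerDr sqr_ge0.
Qed.

(** A bounded set lies in the image of a compact square under the continuous map
    (x, y) -> x + i y. *)
Lemma complex_bounded_closed_compact (A : set R[i]^o) (c : R) :
  closed A -> (forall z, A z -> modulus z <= c) -> compact A.
Proof.
move=> cA Ac.
pose Q : set R[i]^o := (fun p : R * R => (p.1 +i* p.2 : R[i]^o)) @`
  (`[- c, c]%classic `*` `[- c, c]%classic).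
apply: (@subclosed_compact _ A Q) => //.
  apply: continuous_compact; last by apply: compact_setX; exact: segment_compact.
  by apply: continuous_subspaceT; exact: complex_of_pair_continuous.
move=> z /Ac zc; exists (complex.Re z, complex.Im z); last by case: z {zc}.
have [h1 h2] := ge_modulus_coord z.
by split; rewrite /= in_itv/= -ler_norml (le_trans _ zc).
Qed.

Lemma complex_compact_closed (A : set R[i]^o) : compact A -> closed A.
Proof. exact: compact_closed (@norm_hausdorff _ _). Qed.

Lemma complex_horner_continuous (p : {poly R[i]}) :
  continuous (fun z : R[i]^o => p.[z] : R[i]^o).
Proof. exact: (@horner_continuous R[i] p). Qed.

Lemma compact_modulus_max (X : topologicalType) (f : X -> R[i]^o) :
  [set: X] !=set0 -> compact [set: X] -> continuous f ->
  exists x, forall y, modulus (f y) <= modulus (f x).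
Proof.
move=> X0 cX cf.
have [x _ xmax] := @compact_EVT_max X R (fun x => modulus (f x)) setT X0 cX
  (continuous_subspaceT (fun x => continuous_comp (cf x) (@modulus_continuous (f x)))).
by exists x => y; apply: xmax; rewrite inE.
Qed.

End ComplexTopology.

(** * Roots of a sequence of exponential growth *)

Section RootLimit.
Context {R : realType}.
Implicit Types (u : nat -> R) (C r : R).

Lemma root_cvg1 C : 0 < C -> (fun n : nat => C `^ (n%:R^-1)) @ \oo --> (1 : R).
Proof.
move=> C0.
have inv0 : (fun n : nat => (n%:R : R)^-1) @ \oo --> (0 : R).
  by rewrite -cvg_shiftS; exact: cvg_harmonic.
rewrite (_ : (fun n => _) = fun n : nat => expR (n%:R^-1 * ln C)); last first.
  by apply/funext => n; rewrite /powR gt_eqF.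
rewrite -[X in _ --> X]expR0 -(mul0r (ln C)).
apply: (continuous_cvg _ (@continuous_expR R _)).
by apply: cvgMr_tmp.
Qed.

Lemma exprn_root (a : R) n : 0 <= a -> (0 < n)%N -> (a ^+ n) `^ (n%:R^-1) = a.
Proof.
move=> a0 n0; rewrite -powR_mulrn// -powRrM mulfV ?powRr1//.
by rewrite pnatr_eq0 -lt0n.
Qed.

Lemma root_le (a C b : R) n : 0 <= a -> 0 <= C -> 0 <= b -> (0 < n)%N ->
  a <= C * b ^+ n -> a `^ (n%:R^-1) <= C `^ (n%:R^-1) * b.
Proof.
move=> a0 C0 b0 n0 ab.
rewrite -[in leRHS](exprn_root b0 n0) -powRM ?exprn_ge0//.
by apply: ge0_ler_powR; rewrite ?nnegrE ?invr_ge0 ?mulr_ge0 ?exprn_ge0.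
Qed.

(** The n-th root removes constant factors, because C^(1/n) tends to 1; the lower
    bound then gives r, and the upper bounds give every s > r. *)
Lemma root_growth_cvg u r : 0 <= r -> (forall n, 0 <= u n) ->
  (exists2 C, 0 < C & forall n, r ^+ n <= C * u n) ->
  (forall s, r < s -> exists C, forall n, u n <= C * s ^+ n) ->
  (fun n : nat => u n `^ (n%:R^-1)) @ \oo --> r.
Proof.
move=> r0 u0 [C C0 rCu] us; apply/cvgrPdist_lt => e e0.
pose s := r + e / 2.
have s0 : 0 < s by rewrite ltr_wpDl// divr_gt0.
have [D uD] : exists C, forall n, u n <= C * s ^+ n.
  by apply: us; rewrite ltrDl divr_gt0.
(* D could vanish; its n-th root would then not tend to 1 *)
have D0 : 0 < Num.max 1 D by rewrite lt_max ltr01.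
have up : (fun n : nat => (Num.max 1 D) `^ (n%:R^-1) * s) @ \oo --> s.
  by rewrite -[X in _ --> X]mul1r; apply: cvgMr_tmp; exact: root_cvg1.
have lo : (fun n : nat => C^-1 `^ (n%:R^-1) * r) @ \oo --> r.
  rewrite -[X in _ --> X]mul1r; apply: cvgMr_tmp; apply: root_cvg1.
  by rewrite invr_gt0.
have s_lt : s < r + e by rewrite ltrD2l ltr_pdivrMr// ltr_pMr// ltr1n.
have lt_r : r - e < r by rewrite ltrBlDr ltrDl.
near=> n.
have n0 : (0 < n)%N by near: n; exists 1%N.
rewrite distrC ltr_distl; apply/andP; split.
  apply: (@lt_le_trans _ _ (C^-1 `^ (n%:R^-1) * r)).
    by near: n; apply: cvgr_gt lo _ lt_r.
  rewrite -[in leLHS](exprn_root r0 n0) -powRM ?exprn_ge0 ?invr_ge0 ?(ltW C0)//.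
  apply: ge0_ler_powR; rewrite ?nnegrE ?invr_ge0//.
    by rewrite mulr_ge0 ?exprn_ge0 ?invr_ge0 ?(ltW C0).
  by rewrite ler_pdivrMl.
apply: (@le_lt_trans _ _ ((Num.max 1 D) `^ (n%:R^-1) * s)).
  apply: root_le => //; [exact: ltW|exact: ltW|].
  rewrite (le_trans (uD n))// ler_wpM2r ?exprn_ge0 ?(ltW s0)//.
  by rewrite le_max lexx orbT.
by near: n; apply: cvgr_lt up _ s_lt.
Unshelve. all: by end_near. Qed.

End RootLimit.

(** * The algebra of continuous functions and its characters *)

Section FunctionAlgebra.
Context {R : realType} {d : nat} (lam : 'I_d -> R[i]) (M : set R[i]^o).
Implicit Types f g : vfun d M.

Lemma CLambdaP f :
  CLambda f <-> forall i, continuous (fun w => f w i 0 : R[i]^o).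
Proof.
have := @continuous_mx_entryP R[i] (set_type M) d 1 f.
move=> [h1 h2]; split=> [cf i|cf]; first exact: (h2 cf i 0).
by apply: h1 => i j; rewrite ord1; exact: cf.
Qed.

Lemma val_set_type_continuous (A : set R[i]^o) :
  continuous (fun z : set_type A => val z : R[i]^o).
Proof. exact: initial_continuous. Qed.

Lemma polyprodE f g w :
  polyprod lam f g w = fibre_mul lam (val w) (f w) (g w).
Proof. by []. Qed.

Lemma CLambda_const (u : 'cV[R[i]]_d) : CLambda ((fun=> u) : vfun d M).
Proof. by apply/CLambdaP => i w; exact: cst_continuous. Qed.

Lemma CLambdaD f g : CLambda f -> CLambda g -> CLambda (fun w => f w + g w).
Proof.
move=> /CLambdaP cf /CLambdaP cg; apply/CLambdaP => i.
under eq_fun do rewrite mxE; exact: (@continuous_add R[i]).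
Qed.

Lemma CLambdaZ c f : CLambda f -> CLambda (fun w => c *: f w).
Proof.
move=> /CLambdaP cf; apply/CLambdaP => i.
under eq_fun do rewrite mxE; apply: (@continuous_mul R[i]) => //.
by move=> w; exact: cst_continuous.
Qed.

Lemma CLambda_polyprod f g : CLambda f -> CLambda g -> CLambda (polyprod lam f g).
Proof.
move=> /CLambdaP cf /CLambdaP cg; apply/CLambdaP => i.
under eq_fun do rewrite mxE.
apply: (@continuous_sub R[i]); first exact: (@continuous_mul R[i]).
apply: (@continuous_mul R[i]); first exact: val_set_type_continuous.
apply: (@continuous_bigsum R[i]) => j _.
apply: (@continuous_mul R[i]); last by move=> w; exact: cst_continuous.
by apply: (@continuous_mul R[i]); exact: (@continuous_sub R[i]).
Qed.

Lemma CLambda_polypow f n : CLambda f -> CLambda (polypow lam f n).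
Proof.
move=> cf; elim: n => [|n IH]; first exact: CLambda_const.
exact: CLambda_polyprod.
Qed.

Lemma polyprodC f g : polyprod lam f g = polyprod lam g f.
Proof. by apply/funext => w; exact: fibre_mulC. Qed.

Lemma polyprod1r f : polyprod lam f (@one_vfun R d M) = f.
Proof. by apply/funext => w; exact: fibre_mul1r. Qed.

Lemma polyprod0l f : polyprod lam (fun=> 0) f = (fun=> 0).
Proof.
apply/funext => w; rewrite polyprodC polyprodE -(scale0r (0 : 'cV[R[i]]_d)).
by rewrite fibre_mulZr !scale0r.
Qed.

Lemma hatE f (z : set_type (lemniscate lam M)) :
  hat lam f z = (interp lam (f (nodal_map z))).[val z].
Proof.
by rewrite /hat horner_sum; apply: eq_bigr => j _; rewrite hornerZ mulrC.
Qed.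

Lemma hatD f g z : hat lam (fun w => f w + g w) z = hat lam f z + hat lam g z.
Proof. by rewrite !hatE interpD hornerD. Qed.

Lemma hatZ c f z : hat lam (fun w => c *: f w) z = c * hat lam f z.
Proof. by rewrite !hatE interpZ hornerZ. Qed.

Lemma nodal_map_continuous :
  continuous (@nodal_map R d lam M).
Proof.
apply: continuous_comp_initial.
rewrite (_ : _ \o _ = (horner (nodal lam)) \o val) // => z.
apply: (@continuous_comp _ R[i]^o R[i]^o); first exact: val_set_type_continuous.
exact: complex_horner_continuous.
Qed.

Lemma hat_continuous f : CLambda f -> continuous (fun z => hat lam f z : R[i]^o).
Proof.
move=> /CLambdaP cf; rewrite /hat.
apply: (@continuous_bigsum R[i]) => j _.
apply: (@continuous_mul R[i]) => z.
  apply: (@continuous_comp _ R[i]^o R[i]^o); first exact: val_set_type_continuous.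
  exact: complex_horner_continuous.
apply: (@continuous_comp _ _ R[i]^o (@nodal_map R d lam M) (fun w => f w j 0)).
  exact: nodal_map_continuous.
exact: cf.
Qed.

Lemma fibre_point (w : set_type M) z : (nodal lam).[z] = val w ->
  exists2 z' : set_type (lemniscate lam M), val z' = z & nodal_map z' = w.
Proof.
move=> zw; have Mz : (lemniscate lam M) z.
  by rewrite /lemniscate /= zw; exact: set_mem (valP w).
exists (SigSub (mem_set Mz)) => //.
by apply: val_inj; rewrite /= zw.
Qed.

Hypothesis d_gt0 : (0 < d)%N.
Hypothesis lam_inj : injective lam.

Lemma polyprodA f g h :
  polyprod lam f (polyprod lam g h) = polyprod lam (polyprod lam f g) h.
Proof. by apply/funext => w; exact: fibre_mulA. Qed.

Lemma polypow_polyprodE f g n w : polyprod lam (polypow lam f n) g w =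
  iter n (fibre_mul lam (val w) (f w)) (g w).
Proof.
elim: n => [|n IH] /=; first by rewrite polyprodC polyprod1r.
by rewrite /polypow /= -polyprodA polyprodE IH.
Qed.

Lemma hat1 z : hat lam (@one_vfun R d M) z = 1.
Proof. by rewrite hatE interp_const1// hornerC. Qed.

Lemma hatM f g z : hat lam (polyprod lam f g) z = hat lam f z * hat lam g z.
Proof. by rewrite !hatE horner_interpM. Qed.

Lemma hatX f n z : hat lam (polypow lam f n) z = hat lam f z ^+ n.
Proof.
by elim: n => [|n IH]; rewrite ?expr0 ?hat1//= /polypow/= hatM IH exprS.
Qed.

(** The inverse at w solves a linear system whose matrix is continuous in w and
    invertible by [fibre_mx_unit]. *)
Lemma invertibleP f : CLambda f ->
  invertible lam f <-> forall z, hat lam f z != 0.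
Proof.
move=> cf; split=> [[g cg fg] z|f0].
  have := congr1 (fun h => hat lam h z) fg; rewrite hatM hat1 => fg1.
  by apply: contra_eq_neq fg1 => ->; rewrite mul0r eq_sym oner_eq0.
have unitA w : fibre_mx lam (val w) (f w) \in unitmx.
  apply: fibre_mx_unit => // z /fibre_point[z' <- <-].
  by rewrite -hatE.
exists (fun w => invmx (fibre_mx lam (val w) (f w)) *m const_mx 1).
  apply/CLambdaP => i; under eq_fun do rewrite mxE.
  apply: (@continuous_bigsum R[i]) => j _.
  apply: (@continuous_mul R[i]); last first.
    by under eq_fun do rewrite mxE; move=> w; exact: cst_continuous.
  apply: (@continuous_invmx R[i]) => // {i} k l.
  under eq_fun do rewrite mxE.
  have /CLambdaP := CLambda_polyprod cf (@CLambda_const (delta_mx l 0)).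
  exact.
by apply/funext => w; rewrite polyprodE -fibre_mxE mulmxA mulmxV// mul1mx.
Qed.

Lemma CLambda_resolvent l f : CLambda f ->
  CLambda ((fun w => l *: one_vfun w - f w) : vfun d M).
Proof.
move=> cf; apply: CLambdaD; first exact: (@CLambda_const (l *: const_mx 1)).
by under eq_fun do rewrite -scaleN1r; exact: CLambdaZ.
Qed.

Lemma hat_resolvent l f z :
  hat lam (fun w => l *: one_vfun w - f w) z = l - hat lam f z.
Proof.
rewrite hatD (hatZ l (@one_vfun R d M)) hat1 mulr1; congr (_ + _).
by rewrite -mulN1r -hatZ; congr hat; apply/funext => w; rewrite scaleN1r.
Qed.

Lemma spectrumE f : CLambda f -> spectrum lam f = range (hat lam f).
Proof.
move=> cf; apply/seteqP; split=> l; rewrite /spectrum /=.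
  apply: contra_notP => nl; apply: (invertibleP (@CLambda_resolvent l _ cf)).2 => z.
  rewrite hat_resolvent subr_eq0; apply/eqP => lz; apply: nl.
  by exists z.
move=> [z _ <-] /(invertibleP (@CLambda_resolvent _ _ cf))/(_ z).
by rewrite hat_resolvent subrr eqxx.
Qed.

Hypothesis M_neq0 : M !=set0.
Hypothesis M_compact : compact M.

Lemma set_type_M_neq0 : [set: set_type M] !=set0.
Proof. by have [w Mw] := M_neq0; exists (SigSub (mem_set Mw)). Qed.

Lemma M_bounded : exists2 W : R, 0 <= W & forall w : set_type M, modulus (val w) <= W.
Proof.
have [w0 h] := compact_modulus_max set_type_M_neq0
  (compact_set_type M_compact) (@val_set_type_continuous M).
by exists (modulus (val w0)) => //; exact: modulus_ge0.
Qed.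

Lemma lemniscate_neq0 : [set: set_type (lemniscate lam M)] !=set0.
Proof.
have [w _] := set_type_M_neq0.
have [r rE [sr rw]] := nodalB_factor lam d_gt0 (val w).
case: r sr rw {rE} => [d0|z r _ rw]; first by have := d_gt0; rewrite -{1}d0.
by have [z' _ _] := fibre_point (rw z (mem_head _ _)); exists z'.
Qed.

(** K is closed as a preimage of M.  It is bounded since a point at distance
    more than max(1, W) from every lambda_j has |p(z)| > W. *)
Lemma lemniscate_compact : compact [set: set_type (lemniscate lam M)].
Proof.
apply: compact_set_type; have [W W0 MW] := M_bounded.
apply: (@complex_bounded_closed_compact _ _
    (Num.max 1 W + \sum_j modulus (lam j))).
  apply: (@preimage_closed R[i]^o R[i]^o) => //.
    by move=> z _; exact: complex_horner_continuous.
  exact: complex_compact_closed.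
move=> z Mz; rewrite leNgt; apply/negP => zbig.
have far j : Num.max 1 W < modulus (z - lam j).
  rewrite -(ltrD2r (modulus (lam j))) (lt_le_trans _ (modulusD_le _ _))// subrK.
  apply: le_lt_trans zbig; rewrite lerD2l (bigD1 j)//= lerDl.
  by apply: sumr_ge0 => k _; exact: modulus_ge0.
have := MW (SigSub (mem_set (Mz : M (nodal lam).[z]))); rewrite /= leNgt => /negP; apply.
rewrite /nodal horner_prod (bigD1 (Ordinal d_gt0))//= hornerXsubC normcM.
set q := \prod_(_ < d | _) _; have q1 : 1 <= modulus q.
  rewrite /q; elim/big_rec: _ => [|j x _ x1]; first by rewrite normc1.
  rewrite normcM hornerXsubC mulr_ege1// ltW// (le_lt_trans _ (far j))//.
  by rewrite le_max lexx.
apply: (@lt_le_trans _ _ (modulus (z - lam (Ordinal d_gt0)))).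
  by rewrite (le_lt_trans _ (far _))// le_max lexx orbT.
by rewrite ler_peMr// modulus_ge0.
Qed.

Lemma hat_max f : CLambda f ->
  exists z0, forall z, modulus (hat lam f z) <= modulus (hat lam f z0).
Proof.
move=> cf; exact: (compact_modulus_max lemniscate_neq0 lemniscate_compact
  (hat_continuous cf)).
Qed.

(** * The maximum norm and the operator norm *)

Lemma colnorm_bounded f : CLambda f -> exists c, forall w, colnorm (f w) <= c.
Proof.
move=> /CLambdaP cf.
have /choice[wmax h] j : exists w0 : set_type M,
    forall w, modulus (f w j 0) <= modulus (f w0 j 0).
  exact: (compact_modulus_max set_type_M_neq0 (compact_set_type M_compact) (cf j)).
exists (\sum_j modulus (f (wmax j) j 0)) => w; apply: colnorm_le => [|j].
  by apply: sumr_ge0 => j _; exact: modulus_ge0.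
rewrite (le_trans (h j w))// (bigD1 j)//= lerDl.
by apply: sumr_ge0 => k _; exact: modulus_ge0.
Qed.

Lemma colnorm_le_max_norm f w : CLambda f -> colnorm (f w) <= max_norm f.
Proof.
move=> cf; have [c fc] := colnorm_bounded cf.
apply: ub_le_sup; last by exists w.
by exists c => _ [v _ <-]; exact: fc.
Qed.

Lemma max_norm_le f c : (forall w, colnorm (f w) <= c) -> max_norm f <= c.
Proof.
move=> fc; have [w0 _] := set_type_M_neq0.
apply: ge_sup; first by exists (colnorm (f w0)), w0.
by move=> _ [v _ <-]; exact: fc.
Qed.

Lemma max_norm_ge0 f : CLambda f -> 0 <= max_norm f.
Proof.
move=> cf; have [w0 _] := set_type_M_neq0.
by rewrite (le_trans (colnorm_ge0 (f w0)))// colnorm_le_max_norm.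
Qed.

Lemma max_norm_one : max_norm (@one_vfun R d M) <= 1.
Proof.
by apply: max_norm_le => w; apply: colnorm_le => // j; rewrite mxE normc1.
Qed.

Lemma max_normZ_le c f : CLambda f ->
  max_norm (fun w => c *: f w) <= modulus c * max_norm f.
Proof.
move=> cf; apply: max_norm_le => w; rewrite (le_trans (colnormZ_le _ _))//.
by rewrite ler_wpM2l ?modulus_ge0// colnorm_le_max_norm.
Qed.

Lemma max_norm_polyprod_le : exists2 L : R, 0 <= L &
  forall f g, CLambda f -> CLambda g ->
    max_norm (polyprod lam f g) <= L * max_norm f * max_norm g.
Proof.
have [W W0 MW] := M_bounded; exists (fibre_mul_bound lam W).
  exact: fibre_mul_bound_ge0.
move=> f g cf cg; apply: max_norm_le => w.
rewrite polyprodE (le_trans (colnorm_fibre_mul_le _ _ _ (MW w)))//.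
have L0 := fibre_mul_bound_ge0 lam W0.
by rewrite ler_pM ?mulr_ge0 ?colnorm_ge0 ?ler_wpM2l ?colnorm_le_max_norm.
Qed.

Lemma op_norm_ub f g : CLambda f -> CLambda g -> max_norm g <= 1 ->
  max_norm (polyprod lam f g) <= op_norm lam f.
Proof.
move=> cf cg g1; have [L L0 hL] := max_norm_polyprod_le.
apply: ub_le_sup; last by exists g.
exists (L * max_norm f) => _ [h [ch h1] <-].
by rewrite (le_trans (hL _ _ cf ch))// ler_piMr// mulr_ge0// max_norm_ge0.
Qed.

Lemma op_norm_le f c :
  (forall g, CLambda g -> max_norm g <= 1 -> max_norm (polyprod lam f g) <= c) ->
  op_norm lam f <= c.
Proof.
move=> fc; apply: ge_sup.
  exists (max_norm (polyprod lam f (@one_vfun R d M))).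
  exists (@one_vfun R d M); last reflexivity.
  split; [exact: (@CLambda_const (const_mx 1))|exact: max_norm_one].
by move=> _ [g [cg g1] <-]; exact: fc.
Qed.

Lemma max_norm_le_op_norm f : CLambda f -> max_norm f <= op_norm lam f.
Proof.
move=> cf; have := op_norm_ub cf (@CLambda_const (const_mx 1)) max_norm_one.
by rewrite polyprod1r.
Qed.

Lemma op_norm_ge0 f : CLambda f -> 0 <= op_norm lam f.
Proof.
by move=> cf; rewrite (le_trans (max_norm_ge0 cf))// max_norm_le_op_norm.
Qed.

Lemma polyprodZr c f g : polyprod lam f (fun w => c *: g w) =
  (fun w => c *: polyprod lam f g w).
Proof. by apply/funext => w; exact: fibre_mulZr. Qed.

(** Homogeneity reduces this to the unit ball; if the norm of g is zero, scaling
    is impossible and the crude bound with the constant L is used instead. *)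
Lemma max_norm_polyprod_le_op f g : CLambda f -> CLambda g ->
  max_norm (polyprod lam f g) <= op_norm lam f * max_norm g.
Proof.
move=> cf cg; have := max_norm_ge0 cg; rewrite le_eqVlt => /predU1P[g0|g0].
  have [L L0 hL] := max_norm_polyprod_le.
  by rewrite (le_trans (hL _ _ cf cg))// -g0 !mulr0.
pose c : R[i] := ((max_norm g)^-1)%:C.
have mc : modulus c = (max_norm g)^-1.
  by rewrite /modulus/= expr0n addr0 sqrtr_sqr ger0_norm// invr_ge0 ltW.
have cg1 : max_norm (fun w => c *: g w) <= 1.
  by rewrite (le_trans (max_normZ_le _ cg))// mc mulVf// gt_eqF.
have := op_norm_ub cf (@CLambdaZ c _ cg) cg1; rewrite polyprodZr => h.
rewrite [in leLHS](_ : polyprod lam f g =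
    (fun w => c^-1 *: (c *: polyprod lam f g w))); last first.
  apply/funext => w; rewrite scalerA mulVf ?scale1r//.
  by apply/eqP => c0; move: mc; rewrite c0 normc0 => /esym/eqP;
     rewrite invr_eq0 gt_eqF.
have cfg := CLambdaZ (c := c) (CLambda_polyprod cf cg).
rewrite (le_trans (max_normZ_le c^-1 cfg))// normcV mc invrK mulrC.
by rewrite ler_wpM2r// ltW.
Qed.

Lemma max_norm_polypow_polyprod_le f g n : CLambda f -> CLambda g ->
  max_norm (polyprod lam (polypow lam f n) g) <= op_norm lam f ^+ n * max_norm g.
Proof.
move=> cf cg; elim: n => [|n IH].
  by rewrite /polypow/= polyprodC polyprod1r expr0 mul1r.
have cfg := CLambda_polyprod (CLambda_polypow (n := n) cf) cg.
rewrite /polypow/= -polyprodA exprS -mulrA.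
apply: (le_trans (max_norm_polyprod_le_op cf cfg)).
by apply: ler_wpM2l IH; exact: op_norm_ge0.
Qed.

Lemma hat_bounded : exists2 C : R, 0 < C &
  forall f z, CLambda f -> modulus (hat lam f z) <= C * max_norm f.
Proof.
have ex (j : 'I_d) : exists z0 : set_type (lemniscate lam M),
    forall z : set_type (lemniscate lam M),
    modulus (lagrange_basis lam j).[val z] <= modulus (lagrange_basis lam j).[val z0].
  have cb : continuous (fun z : set_type (lemniscate lam M) =>
      (lagrange_basis lam j).[val z] : R[i]^o).
    move=> z; apply: (@continuous_comp _ R[i]^o R[i]^o).
      exact: val_set_type_continuous.
    exact: complex_horner_continuous.
  exact: (compact_modulus_max lemniscate_neq0 lemniscate_compact cb).
have [zmax h] := choice ex.
exists (1 + \sum_j modulus (lagrange_basis lam j).[val (zmax j) : R[i]]).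
  by rewrite ltr_pwDl//; apply: sumr_ge0 => j _; exact: modulus_ge0.
move=> f z cf; rewrite mulrDl mul1r -[leLHS]add0r lerD ?max_norm_ge0//.
rewrite (le_trans (modulus_sum_le _ _ _))// mulr_suml; apply: ler_sum => j _.
rewrite normcM ler_pM ?modulus_ge0//.
by rewrite (le_trans (modulus_le_colnorm _ j))// colnorm_le_max_norm.
Qed.

Lemma hat_le_norm f z : CLambda f -> modulus (hat lam f z) <= hat_norm lam f.
Proof.
move=> cf; have [z0 z0max] := hat_max cf.
apply: ub_le_sup; last by exists z.
by exists (modulus (hat lam f z0)) => _ [y _ <-].
Qed.

Lemma hat_norm_attained f : CLambda f ->
  exists z0, hat_norm lam f = modulus (hat lam f z0).
Proof.
move=> cf; have [z0 z0max] := hat_max cf; exists z0.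
apply/eqP; rewrite eq_le hat_le_norm// andbT.
apply: ge_sup; first by exists (modulus (hat lam f z0)), z0.
by move=> _ [y _ <-].
Qed.

(** * Gelfand's formula and the spectral radius *)

Lemma hat_norm_ge0 f : CLambda f -> 0 <= hat_norm lam f.
Proof.
move=> cf; have [z0 ->] := hat_norm_attained cf.
exact: modulus_ge0.
Qed.

Lemma op_norm_polypow_le f n : CLambda f ->
  op_norm lam (polypow lam f n) <= op_norm lam f ^+ n.
Proof.
move=> cf.
apply: op_norm_le => g cg g1.
apply: (le_trans (max_norm_polypow_polyprod_le n cf cg)).
apply: ler_piMr g1; apply: exprn_ge0.
exact: op_norm_ge0 _ cf.
Qed.

(** On the fibre over w the multiplication by f(w) is annihilated by factors
    whose roots are values of f-hat, all of modulus at most |f-hat|_K. *)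
Lemma op_norm_polypow_growth f s : CLambda f -> hat_norm lam f < s ->
  exists C, forall n, op_norm lam (polypow lam f n) <= C * s ^+ n.
Proof.
move=> cf rs; have r0 := hat_norm_ge0 cf.
have [W W0 MW] := M_bounded.
pose L := fibre_mul_bound lam W * max_norm f.
have L0 : 0 <= L.
  by apply: mulr_ge0; [exact: fibre_mul_bound_ge0|exact: max_norm_ge0 cf].
have C0 := growth_const_ge0 d r0 rs L0.
have s0 : 0 <= s by exact: le_trans (ltW rs).
exists (growth_const s (hat_norm lam f) L d) => n.
apply: op_norm_le => g cg g1.
apply: max_norm_le => w; rewrite polypow_polyprodE//.
have fw := colnorm_le_max_norm w cf.
apply: (le_trans (fibre_power_growth d_gt0 lam_inj _ _ r0 rs (MW w) fw _)).
  move=> z /fibre_point[z' <- <-]; rewrite -hatE.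
  exact: hat_le_norm.
apply: ler_piMr; first by rewrite mulr_ge0// exprn_ge0.
by apply: le_trans g1; exact: colnorm_le_max_norm.
Qed.

(** Evaluation at a point z0 where |f-hat| is maximal is multiplicative and
    bounded by a constant multiple of the maximum norm. *)
Lemma hat_norm_pow_le f : CLambda f -> exists2 C : R, 0 < C &
  forall n, hat_norm lam f ^+ n <= C * op_norm lam (polypow lam f n).
Proof.
move=> cf; have [C C0 hC] := hat_bounded.
exists C => // n; have [z0 ->] := hat_norm_attained cf.
have cfn := CLambda_polypow (n := n) cf.
rewrite -modulusX -hatX//; apply: (le_trans (hC _ z0 cfn)).
apply: ler_wpM2l; first exact: ltW.
exact: max_norm_le_op_norm.
Qed.

Lemma op_norm_root_cvg f : CLambda f ->
  (fun n : nat => op_norm lam (polypow lam f n) `^ (n%:R^-1)) @ \oo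
     --> hat_norm lam f.
Proof.
move=> cf; apply: root_growth_cvg.
- exact: hat_norm_ge0.
- by move=> n; apply: op_norm_ge0; exact: CLambda_polypow.
- exact: hat_norm_pow_le.
- by move=> s; exact: op_norm_polypow_growth.
Qed.

Lemma hat_norm_le_op_norm f : CLambda f -> hat_norm lam f <= op_norm lam f.
Proof.
move=> cf; apply: (cvgr_to_le (op_norm_root_cvg cf)).
have f0 : 0 <= op_norm lam f by exact: op_norm_ge0.
exists 1%N => // n /= n0; rewrite -[leRHS](exprn_root f0 n0).
apply: ge0_ler_powR.
- by rewrite invr_ge0.
- by rewrite nnegrE; apply: op_norm_ge0; exact: CLambda_polypow.
- by rewrite nnegrE exprn_ge0.
- exact: op_norm_polypow_le.
Qed.

Lemma spectral_radiusE f : CLambda f -> spectral_radius lam f = hat_norm lam f.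
Proof.
move=> cf; rewrite /spectral_radius /hat_norm spectrumE//; congr sup.
apply/seteqP; split => x.
  by move=> [_ [z _ <-] <-]; exists z.
by move=> [z _ <-]; exists (hat lam f z) => //; exists z.
Qed.

Lemma spectral_radius_max f : CLambda f ->
  is_max [set modulus l | l in spectrum lam f] (spectral_radius lam f).
Proof.
move=> cf; rewrite spectral_radiusE// spectrumE//; split.
  have [z0 ->] := hat_norm_attained cf.
  by exists (hat lam f z0) => //; exists z0.
by move=> _ [_ [z _ <-] <-]; exact: hat_le_norm.
Qed.

(** * Maximal ideals and the radical *)

Definition character_kernel (z : set_type (lemniscate lam M)) : set (vfun d M) :=
  [set f | CLambda f /\ hat lam f z = 0].

Lemma hat0 z : hat lam ((fun=> 0) : vfun d M) z = 0.
Proof. by rewrite /hat big1// => j _; rewrite mxE mulr0. Qed.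

Lemma ideal_character_kernel z : ideal lam (character_kernel z).
Proof.
split=> [f []//||f g [cf f0] [cg g0]|f g cf [cg g0]].
- split; [exact: (@CLambda_const 0)|exact: hat0].
- split; first exact: CLambdaD.
  by rewrite hatD f0 g0 addr0.
- split; first exact: CLambda_polyprod.
  by rewrite hatM// g0 mulr0.
Qed.

Lemma idealZ (J : set (vfun d M)) c f : ideal lam J -> J f -> J (fun w => c *: f w).
Proof.
move=> [JC _ _ JM] Jf.
have := JM _ _ (@CLambda_const (c *: const_mx 1)) Jf; congr J.
rewrite polyprodC; apply/funext => w.
by rewrite polyprodE fibre_mulZr fibre_mul1r.
Qed.

Lemma ideal_one (J : set (vfun d M)) :
  ideal lam J -> J (@one_vfun R d M) -> J = @CLambda R d M.
Proof.
move=> [JC _ _ JM] J1; apply/seteqP; split => // f cf.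
by rewrite -(polyprod1r f); exact: JM.
Qed.

(** The kernel of a linear form has codimension one: if g lies in I but not in
    the kernel, then 1 - c g is in the kernel for c = 1 / g-hat(z). *)
Lemma maximal_character_kernel z : maximal_ideal lam (character_kernel z).
Proof.
split; first exact: ideal_character_kernel.
  move=> /seteqP[_ /(_ _ (@CLambda_const (const_mx 1)))[_]].
  by rewrite hat1 => /eqP; rewrite oner_eq0.
move=> I idI kI; have [IC I0 ID IM] := idI.
have [[g [Ig g0]]|nog] := pselect (exists g, I g /\ hat lam g z != 0).
  right; apply: ideal_one => //.
  pose c := (hat lam g z)^-1.
  have Icg := idealZ c idI Ig.
  have kd : I (fun w => one_vfun w - c *: g w).
    apply: kI; split.
      apply: CLambdaD; first exact: (@CLambda_const (const_mx 1)).
      under eq_fun do rewrite -scaleNr.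
      by apply: CLambdaZ; exact: IC.
    under [X in hat _ X _]eq_fun do rewrite -scaleNr.
    by rewrite hatD hatZ hat1 mulNr mulVf// subrr.
  by have := ID _ _ kd Icg; congr I; apply/funext => w; rewrite subrK.
left; apply/seteqP; split => // f If; split; first exact: IC.
by apply/eqP; apply/negPn/negP => f0; apply: nog; exists f.
Qed.

(** For the inclusion from right to left, I = J + C_Lambda f is an ideal
    containing J, hence equal to J or to the whole algebra. *)
Lemma jacobson_radicalE :
  jacobson_radical lam M = [set f | CLambda f /\ forall z, hat lam f z = 0].
Proof.
apply/seteqP; split => f [cf hf]; split => //.
  by move=> z; have [_] := hf _ (maximal_character_kernel z).
move=> J [idJ JN Jmax]; have [JC J0 JD JM] := idJ.
pose I : set (vfun d M) := [set h | exists j g,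
  [/\ J j, CLambda g & h = fun w => j w + polyprod lam g f w]].
have idI : ideal lam I.
  split.
  - move=> _ [j [g [Jj cg ->]]]; apply: CLambdaD; first exact: JC.
    exact: CLambda_polyprod.
  - exists (fun=> 0), (fun=> 0); split; [exact: J0|exact: (@CLambda_const 0)|].
    by apply/funext => w; rewrite polyprod0l add0r.
  - move=> _ _ [j1 [g1 [J1 c1 ->]]] [j2 [g2 [J2 c2 ->]]].
    exists (fun w => j1 w + j2 w), (fun w => g1 w + g2 w).
    split; [exact: JD|exact: CLambdaD|].
    apply/funext => w; rewrite ![polyprod _ _ f]polyprodC !polyprodE fibre_mulDr.
    by rewrite addrACA.
  - move=> h _ ch [j [g [Jj cg ->]]].
    exists (polyprod lam h j), (polyprod lam h g).
    split; [exact: JM|exact: CLambda_polyprod|].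
    apply/funext => w; rewrite -polyprodA//.
    by rewrite [LHS]polyprodE fibre_mulDr.
have JI : J `<=` I.
  move=> j Jj; exists j, (fun=> 0); split; [exact: Jj|exact: (@CLambda_const 0)|].
  by apply/funext => w; rewrite polyprod0l addr0.
have [IJ|IC] := Jmax I idI JI.
  rewrite -IJ; exists (fun=> 0), (@one_vfun R d M).
  split; [exact: J0|exact: (@CLambda_const (const_mx 1))|].
  by rewrite polyprodC polyprod1r; apply/funext => w; rewrite add0r.
have : I (@one_vfun R d M) by rewrite IC; exact: (@CLambda_const (const_mx 1)).
move=> [j [g [Jj cg onej]]]; exfalso; apply: JN; apply: ideal_one => //.
have cj := JC _ Jj.
have [k ck jk] : invertible lam j.
  apply/(invertibleP cj) => z.
  have := congr1 (fun h => hat lam h z) onej.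
  by rewrite hatD hatM// hf mulr0 addr0 hat1// => <-; rewrite oner_eq0.
by rewrite -jk polyprodC; exact: JM.
Qed.

End FunctionAlgebra.

Theorem theorem2p17 (R : realType) (d : nat) (d_gt0 : (0 < d)%N)
  (lam : 'I_d -> R[i]) (lam_inj : injective lam)
  (M : set R[i]^o) (M_neq0 : M !=set0) (M_compact : compact M) :
  (forall f : vfun d M, CLambda f ->
    [/\ spectrum lam f = range (hat lam f),
        [/\ is_max [set modulus l | l in spectrum lam f]
                   (spectral_radius lam f),
            spectral_radius lam f = hat_norm lam f,
            (fun n : nat => op_norm lam (polypow lam f n) `^ (n%:R^-1)) @ \oo
              --> hat_norm lam f &
            hat_norm lam f <= op_norm lam f] &
        invertible lam f <-> (forall z, hat lam f z != 0)])
  /\ jacobson_radical lam M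
     = [set f | CLambda f /\ forall z, hat lam f z = 0].
Proof.
split; last exact: jacobson_radicalE.
move=> f cf; split; [exact: spectrumE| |exact: invertibleP].
split.
- exact: spectral_radius_max.
- exact: spectral_radiusE.
- exact: op_norm_root_cvg.
- exact: hat_norm_le_op_norm.
Qed.
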